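(* Let $Y,U\in\mathbb{R}_+^{(N+1)\times m}$ be given, with associated sets $\boldsymbol{\mathcal{Y}},\boldsymbol{\mathcal{W}}\subset\mathcal{H}_3$. (a) Let $\mathbf{W}\in\mathcal{H}_3$ and let $\mathbf{Y}^*(\mathbf{W})$ be a solution of the problem of minimizing $\mathcal{I}(\mathbf{Y}\|\mathbf{W})$ over $\mathbf{Y}\in\boldsymbol{\mathcal{Y}}$. Then for all $\mathbf{Y}\in\boldsymbol{\mathcal{Y}}$, $$\mathcal{I}(\mathbf{Y}\|\mathbf{W})=\mathcal{I}(\mathbf{Y}\|\mathbf{Y}^*(\mathbf{W}))+\mathcal{I}(\mathbf{Y}^*(\mathbf{W})\|\mathbf{W}).$$ (b) Let $\mathbf{Y}\in\mathcal{H}_3$ and let $\mathbf{W}^*(\mathbf{Y})$ be a solution of the problem of minimizing $\mathcal{I}(\mathbf{Y}\|\mathbf{W})$ over $\mathbf{W}\in\boldsymbol{\mathcal{W}}$. Then for all $\mathbf{W}\in\boldsymbol{\mathcal{W}}$, $$\mathcal{I}(\mathbf{Y}\|\mathbf{W})=\mathcal{I}(\mathbf{Y}\|\mathbf{W}^*(\mathbf{Y}))+\mathcal{I}(\mathbf{W}^*(\mathbf{Y})\|\mathbf{W}).$$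
   Context: $N\ge 0$ and $m\ge 1$ are integers. Rows of $Y,U$ are indexed by $0,\dots,N$, columns by $1,\dots,m$; $U_{ij}:=0$ for $i<0$. $\mathcal{H}=\mathbb{R}_+^{N+1}$ (nonnegative entries) and $\mathcal{H}_3=\mathbb{R}_+^{(N+1)\times(N+1)\times m}$, whose elements $\mathbf{M}=(\mathbf{M}_{ilj})$ have $i,l\in\{0,\dots,N\}$, $j\in\{1,\dots,m\}$. Define $$\boldsymbol{\mathcal{Y}}=\Big\{\mathbf{Y}\in\mathcal{H}_3:\ \sum_{l=0}^N\mathbf{Y}_{ilj}=Y_{ij}\ \text{for all } i,j\Big\},\qquad \boldsymbol{\mathcal{W}}=\big\{\mathbf{W}\in\mathcal{H}_3:\ \mathbf{W}_{ilj}=h_lU_{i-l,j}\ \text{for all } i,l,j,\ \text{for some } h\in\mathcal{H}\big\}.$$ For nonnegative arrays $A,B$ of the same size, the I-divergence is $\mathcal{I}(A\|B)=\sum\big(A\log\frac{A}{B}-A+B\big)$, summed over all entries, if each entry of $A$ vanishes whenever the corresponding entry of $B$ does, and $\mathcal{I}(A\|B)=+\infty$ otherwise, with the conventions $\frac00=0$, $0\log 0=0$. Identities are understood in $[0,+\infty]$. *)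

(* Defs.v *)
From HB Require Import structures.
From mathcomp Require Import all_boot all_order all_algebra.
From mathcomp Require Import all_classical all_reals all_analysis.

Set Implicit Arguments.
Unset Strict Implicit.
Unset Printing Implicit Defensive.

Import Order.TTheory GRing.Theory Num.Theory.

Local Open Scope classical_set_scope.
Local Open Scope ring_scope.

Definition nonneg_array (R : realType) (T : finType) : set {ffun T -> R} :=
  [set A | forall t, 0 <= A t].

Definition nonneg_matrix (R : realType) (p q : nat) : set 'M[R]_(p, q) :=
  [set A | forall i j, 0 <= A i j].

(* The conventions 0/0 = 0 and 0 log 0 = 0 hold here because [x / 0 = 0] and
   [ln 0 = 0]; the other values of the form [x / 0] fall in the [+oo] branch. *)
Definition Idiv (R : realType) (T : finType) (A B : {ffun T -> R}) : \bar R :=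
  if [forall t, (B t == 0) ==> (A t == 0)]
  then (\sum_(t : T) (A t * ln (A t / B t) - A t + B t))%:E
  else +oo%E.

(* The entry M_{ilj} of M is [M (i, l, j)]. The column indices 1, ..., m are
   shifted to 0, ..., m - 1. *)
Definition tensor (R : realType) (N m : nat) : Type :=
  {ffun 'I_N.+1 * 'I_N.+1 * 'I_m -> R}.

Definition H3 (R : realType) (N m : nat) : set (tensor R N m) :=
  @nonneg_array R ('I_N.+1 * 'I_N.+1 * 'I_m)%type.

(* U_{i-l,j}, with U_{kj} = 0 for k < 0; the subtraction is the one of nat, not
   the modular one of the ordinals. *)
Definition lag (R : realType) (N m : nat) (U : 'M[R]_(N.+1, m))
    (i l : 'I_N.+1) (j : 'I_m) : R :=
  if (l <= i)%N then U (inord (i - l)%N) j else 0.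

Definition calY (R : realType) (N m : nat) (Y : 'M[R]_(N.+1, m)) :
    set (tensor R N m) :=
  [set bY | H3 bY /\ forall i j, \sum_(l < N.+1) bY (i, l, j) = Y i j].

Definition calW (R : realType) (N m : nat) (U : 'M[R]_(N.+1, m)) :
    set (tensor R N m) :=
  [set bW | H3 bW /\
    exists2 h : {ffun 'I_N.+1 -> R}, nonneg_array h &
      forall i l j, bW (i, l, j) = h l * lag U i l j].

(* A minimizer need not have a finite value of the objective. *)
Definition is_minimizer (R : realType) (T : Type) (S : set T)
    (F : T -> \bar R) (x : T) : Prop :=
  S x /\ forall y, S y -> (F x <= F y)%E.

(* Main.v *)
Require Import Defs.
From HB Require Import structures.
From mathcomp Require Import all_boot all_order all_algebra.
From mathcomp Require Import all_classical all_reals all_analysis.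
From mathcomp Require Import ring lra.

Set Implicit Arguments.
Unset Strict Implicit.
Unset Printing Implicit Defensive.

Import Order.TTheory GRing.Theory Num.Theory.

Local Open Scope classical_set_scope.
Local Open Scope ring_scope.

(** Both problems ask for a tensor whose sums over the fibres of a projection
    [p] are prescribed ([p = (i, j)] in (a), [p = l] in (b)), inside a family of
    tensors of the form [g (p t) * D t].  If [B = (g \o p) * D] has the same
    fibre sums as [A] and [C = (c \o p) * D], then [ln (B / C)] depends on
    [p t] only, so [\sum (A - B) * ln (B / C) = 0], which is the Pythagorean
    identity [I(A||C) = I(A||B) + I(B||C)].  In each problem the candidate
    obtained by rescaling on the fibres therefore satisfies the identity, and the
    identity forces any minimizer of finite value to be that candidate.  When the
    minimal value is infinite, both sides are infinite. *)

Section IDivergence.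
Variables (R : realType) (T : finType).
Implicit Types A B C D : {ffun T -> R}.

Definition dominated A B := [forall t, (B t == 0) ==> (A t == 0)].

Lemma dominatedP A B : reflect (forall t, B t = 0 -> A t = 0) (dominated A B).
Proof.
apply: (iffP forallP) => [H t Bt0|H t].
  by have := H t; rewrite Bt0 eqxx => /eqP.
by apply/implyP => /eqP /H ->.
Qed.

Lemma Idiv_fin A B : dominated A B ->
  Idiv A B = (\sum_(t : T) (A t * ln (A t / B t) - A t + B t))%:E.
Proof. by rewrite /Idiv /dominated => ->. Qed.

Lemma Idiv_pinfty A B : ~~ dominated A B -> Idiv A B = +oo%E.
Proof. by rewrite /Idiv /dominated => /negbTE ->. Qed.

Lemma Idiv_neqNy A B : Idiv A B != -oo%E.
Proof. by rewrite /Idiv; case: ifP. Qed.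

(** For [a > 0], apply the strict bound [1 + x < expR x] at [x = - ln (a / b)], which is nonzero
    because [a != b], and multiply by [a]. *)
Lemma idiv_term_gt0 (a b : R) : 0 <= a -> 0 <= b -> (b = 0 -> a = 0) ->
  a != b -> 0 < a * ln (a / b) - a + b.
Proof.
move=> a0 b0 ba neq_ab.
have b_gt0 : 0 < b.
  rewrite lt_neqAle b0 andbT eq_sym; apply/eqP => bE.
  by move: neq_ab; rewrite (ba bE) bE eqxx.
have [aE|a_neq0] := eqVneq a 0; first by rewrite aE mul0r subr0 add0r.
have a_gt0 : 0 < a by rewrite lt_neqAle eq_sym a_neq0.
have ab_gt0 : 0 < a / b by rewrite divr_gt0.
have x_neq0 : - ln (a / b) != 0.
  rewrite oppr_eq0 ln_eq0 //; apply/eqP => abE.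
  by move: neq_ab; rewrite -(divfK (lt0r_neq0 b_gt0) a) abE mul1r eqxx.
have := expR_gt1Dx x_neq0.
rewrite expRN lnK ?posrE // invf_div ltr_pdivlMr // mulrC mulrDr mulr1 mulrN.
lra.
Qed.

(** Every term of the sum is nonnegative, and positive where the entries differ, so one differing
    entry would make the divergence positive. This is what later identifies a minimizer with an
    explicit candidate. *)
Lemma Idiv_le0_eq A B : nonneg_array A -> nonneg_array B ->
  (Idiv A B <= 0)%E -> A = B.
Proof.
move=> A0 B0; have [dAB|/Idiv_pinfty ->] := boolP (dominated A B); last first.
  by rewrite leye_eq.
rewrite (Idiv_fin dAB) lee_fin => sum_le0; apply/ffunP => t; apply/eqP.
have term_ge0 u : 0 <= A u * ln (A u / B u) - A u + B u.
  have [AB|/idiv_term_gt0 H] := eqVneq (A u) (B u); last first.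
    by apply/ltW/H => //; exact/dominatedP.
  rewrite AB; have [->|Bu] := eqVneq (B u) 0; first by rewrite mul0r subr0 addr0.
  by rewrite divff // ln1 mulr0 sub0r addNr.
apply: contraT => /idiv_term_gt0 H.
have := H (A0 t) (B0 t) (dominatedP _ _ dAB t).
rewrite (bigD1 t) //= in sum_le0.
rewrite ltNge => /negP[]; apply: le_trans sum_le0.
by rewrite lerDl sumr_ge0.
Qed.

Section Fibres.
Variables (K : finType) (p : T -> K).

Definition fibre_sum A k := \sum_(t | p t == k) A t.

Lemma fibre_sum_eq0 A t : nonneg_array A -> fibre_sum A (p t) = 0 -> A t = 0.
Proof.
move=> A0 /eqP; rewrite psumr_eq0 // => /allP /(_ t).
by rewrite mem_index_enum eqxx => /(_ isT) /eqP.
Qed.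

Lemma sum_fibre_mul A B (f : K -> R) :
  (forall k, fibre_sum A k = fibre_sum B k) ->
  \sum_t (A t - B t) * f (p t) = 0.
Proof.
move=> sumE; rewrite (partition_big p xpredT) //= big1 // => k _.
rewrite (eq_bigr (fun t => (A t - B t) * f k)); last by move=> t /eqP ->.
by rewrite -mulr_suml sumrB -/(fibre_sum A k) sumE subrr mul0r.
Qed.

Lemma Idiv_pythagoras A B C D (g c : K -> R) :
  nonneg_array A -> nonneg_array B -> nonneg_array C ->
  (forall k, fibre_sum A k = fibre_sum B k) ->
  (forall t, B t = g (p t) * D t) -> (forall t, C t = c (p t) * D t) ->
  Idiv A C = (Idiv A B + Idiv B C)%E.
Proof.
move=> A0 B0 C0 sumE BE CE.
have fibre0 t : (forall u, p u = p t -> B u = 0) -> A t = 0.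
  move=> Bp; apply: fibre_sum_eq0 => //; rewrite sumE.
  by apply: big1 => u /eqP /Bp.
have [dAC|dAC] := boolP (dominated A C); last first.
  rewrite (Idiv_pinfty dAC).
  have [dAB|/Idiv_pinfty ->] := boolP (dominated A B); last first.
    by rewrite addye ?Idiv_neqNy.
  suff /Idiv_pinfty -> : ~~ dominated B C by rewrite addey ?Idiv_neqNy.
  apply: contra dAC => dBC; apply/dominatedP => t Ct0.
  by apply: (dominatedP _ _ dAB); exact: (dominatedP _ _ dBC).
(* A zero of [B] has two sources. If [D] vanishes there, so does [C], hence [A]. If [g] vanishes,
   [B] is zero on the whole fibre, and the common fibre sum forces [A] to be zero on it. The next
   claim splits the zeros of [C] in the same way. *)
have dAB : dominated A B.
  apply/dominatedP => t Bt0; have := BE t; rewrite Bt0 => /esym/eqP.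
  rewrite mulf_eq0 => /orP[/eqP g0|/eqP D0]; last first.
    by apply: (dominatedP _ _ dAC); rewrite CE D0 mulr0.
  by apply: fibre0 => u pu; rewrite BE pu g0 mul0r.
have dBC : dominated B C.
  apply/dominatedP => t; rewrite CE => /eqP; rewrite mulf_eq0.
  case/orP => [/eqP c0|/eqP D0]; last by rewrite BE D0 mulr0.
  apply: fibre_sum_eq0 => //; rewrite -sumE; apply: big1 => u /eqP pu.
  by apply: (dominatedP _ _ dAC); rewrite CE pu c0 mul0r.
rewrite !Idiv_fin // -EFinD -big_split /=; congr (_%:E).
apply/eqP; rewrite -subr_eq0 -sumrB; apply/eqP.
rewrite -[RHS](sum_fibre_mul (fun k => ln (g k / c k)) sumE).
apply: eq_bigr => t _.
(* Where [B] vanishes so does [A], and both summands are zero whatever the logarithms are. Elsewhere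
   [C], [D] and [c] are nonzero, so [D] cancels in [B t / C t]. *)
have [Bt0|Bt] := eqVneq (B t) 0.
  by rewrite Bt0 (dominatedP _ _ dAB _ Bt0); ring.
have Ct : C t != 0 by apply: contra_neq Bt => /(dominatedP _ _ dBC).
have Dt : D t != 0 by apply: contra_neq Bt => Dt0; rewrite BE Dt0 mulr0.
have ct : c (p t) != 0 by apply: contra_neq Ct => ct0; rewrite CE ct0 mul0r.
have -> : g (p t) / c (p t) = B t / C t.
  by rewrite BE CE; field; rewrite ct Dt.
have [->|At] := eqVneq (A t) 0; first by ring.
have pos (x : R) : 0 <= x -> x != 0 -> x \in Num.pos.
  by move=> x0 xn0; rewrite posrE lt_neqAle eq_sym xn0.
by rewrite !ln_div ?pos //; ring.
Qed.

(** On a fibre where [B] sums to zero the quotient is 0 by convention; this is harmless, since a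
    nonnegative [B] is already zero there. *)
Definition rescale A B : {ffun T -> R} :=
  [ffun t => (fibre_sum A (p t) / fibre_sum B (p t)) * B t].

Lemma rescale_ge0 A B :
  nonneg_array A -> nonneg_array B -> nonneg_array (rescale A B).
Proof.
by move=> A0 B0 t; rewrite ffunE mulr_ge0 // divr_ge0 // sumr_ge0.
Qed.

Lemma rescale_dominated A B : dominated (rescale A B) B.
Proof. by apply/dominatedP => t; rewrite ffunE => ->; rewrite mulr0. Qed.

Lemma dominated_rescale A B : nonneg_array A -> nonneg_array B ->
  dominated A B -> dominated A (rescale A B).
Proof.
move=> A0 B0 dAB; apply/dominatedP => t; rewrite ffunE => /eqP.
rewrite mulf_eq0 => /orP[|/eqP]; last exact/dominatedP.
rewrite mulf_eq0 invr_eq0 => /orP[] /eqP; first exact: fibre_sum_eq0.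
by move/fibre_sum_eq0 => Bt0; apply: (dominatedP _ _ dAB); exact: Bt0.
Qed.

Lemma fibre_sum_rescale A B k : nonneg_array B -> dominated A B ->
  fibre_sum (rescale A B) k = fibre_sum A k.
Proof.
move=> B0 dAB.
transitivity (fibre_sum A k / fibre_sum B k * fibre_sum B k).
  by rewrite /fibre_sum mulr_sumr; apply: eq_bigr => t /eqP pt; rewrite ffunE pt.
have [Bk0|?] := eqVneq (fibre_sum B k) 0; last by rewrite divfK.
rewrite Bk0 mulr0; apply/esym/big1 => t /eqP pt.
by apply: (dominatedP _ _ dAB); apply: fibre_sum_eq0 => //; rewrite pt.
Qed.

End Fibres.
End IDivergence.

Section Tensors.
Variables (R : realType) (N m : nat).
Implicit Types bY bW : tensor R N m.

Definition row_col (t : 'I_N.+1 * 'I_N.+1 * 'I_m) := (t.1.1, t.2).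
Definition lag_index (t : 'I_N.+1 * 'I_N.+1 * 'I_m) := t.1.2.

Lemma fibre_sum_row_col bY i j :
  fibre_sum row_col bY (i, j) = \sum_l bY (i, l, j).
Proof.
rewrite /fibre_sum (reindex_onto (fun l => (i, l, j)) lag_index) /=.
  by apply: eq_bigl => l; rewrite /row_col /lag_index /= !eqxx.
by case=> [[i' l'] j'] /eqP [/= -> ->].
Qed.

Lemma calY_pythagoras (Y : 'M[R]_(N.+1, m)) bW Ystar bY :
  H3 bW -> is_minimizer (calY Y) (fun bY => Idiv bY bW) Ystar -> calY Y bY ->
  Idiv bY bW = (Idiv bY Ystar + Idiv Ystar bW)%E.
Proof.
move=> W0 [[Ys0 YsE] Ysmin] Yin.
have [dYsW|dYsW] := boolP (dominated Ystar bW); last first.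
  have := Ysmin _ Yin; rewrite (Idiv_pinfty dYsW) leye_eq => /eqP ->.
  by rewrite addey ?Idiv_neqNy.
(* [Ystar] enters only through its fibre sums, which are the entries of [Y]; its domination by [bW]
   makes these sums attainable by rescaling [bW]. *)
pose Yhat := rescale row_col Ystar bW.
have Yhat0 : H3 Yhat by exact: rescale_ge0.
have YhatE k : fibre_sum row_col Yhat k = Y k.1 k.2.
  by rewrite fibre_sum_rescale //; case: k => i j; rewrite fibre_sum_row_col.
have pyth bY' : calY Y bY' -> Idiv bY' bW = (Idiv bY' Yhat + Idiv Yhat bW)%E.
  move=> [Y'0 Y'E].
  apply: (Idiv_pythagoras (D := bW) (p := row_col) (c := fun=> 1)
    (g := fun k => fibre_sum row_col Ystar k / fibre_sum row_col bW k)) => //.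
  - by move=> k; rewrite YhatE; case: k => i j; rewrite fibre_sum_row_col.
  - by move=> t; rewrite ffunE.
  - by move=> t; rewrite mul1r.
suff -> : Ystar = Yhat by exact: pyth.
apply: Idiv_le0_eq => //.
have Yhatin : calY Y Yhat.
  by split=> // i j; rewrite -fibre_sum_row_col YhatE.
(* Minimality now reads [Idiv Ystar Yhat + Idiv Yhat bW <= Idiv Yhat bW]; the term [Idiv Yhat bW] is
   finite and cancels. *)
have := Ysmin _ Yhatin; rewrite pyth //.
by rewrite -{2}[Idiv Yhat bW]add0e leeD2rE // (Idiv_fin (rescale_dominated _ _ _)).
Qed.

Lemma calW_pythagoras (U : 'M[R]_(N.+1, m)) bY Wstar bW :
  H3 bY -> is_minimizer (calW U) (fun bW => Idiv bY bW) Wstar -> calW U bW ->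
  Idiv bY bW = (Idiv bY Wstar + Idiv Wstar bW)%E.
Proof.
move=> Y0 [[Ws0 [h h0 WsE]] Wsmin] Win.
have [dYWs|dYWs] := boolP (dominated bY Wstar); last first.
  have := Wsmin _ Win; rewrite (Idiv_pinfty dYWs) leye_eq => /eqP ->.
  by rewrite addye ?Idiv_neqNy.
(* Rescaling over the fibres of [l] only changes [h l] into [r l * h l], so the candidate stays in
   [calW U]; [D] is the factor shared by all its members. *)
pose What := rescale lag_index bY Wstar.
pose r l := fibre_sum lag_index bY l / fibre_sum lag_index Wstar l.
pose D : tensor R N m := [ffun t => lag U t.1.1 t.1.2 t.2].
have What0 : H3 What by exact: rescale_ge0.
have WhatE i l j : What (i, l, j) = r l * h l * lag U i l j.
  by rewrite ffunE WsE mulrA.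
have pyth bW' : calW U bW' -> Idiv bY bW' = (Idiv bY What + Idiv What bW')%E.
  move=> [W'0 [h' _ W'E]].
  apply: (Idiv_pythagoras (D := D) (p := lag_index) (c := h')
    (g := fun l => r l * h l)) => //.
  - by move=> k; rewrite fibre_sum_rescale.
  - by move=> [[i l] j]; rewrite WhatE ffunE.
  - by move=> [[i l] j]; rewrite W'E ffunE.
suff <- : What = Wstar by exact: pyth.
apply: Idiv_le0_eq => //.
have Whatin : calW U What.
  split=> //; exists [ffun l => r l * h l].
    by move=> l; rewrite ffunE mulr_ge0 // divr_ge0 // sumr_ge0.
  by move=> i l j; rewrite WhatE ffunE.
(* The identity is applied to [Wstar] itself; the finite term [Idiv bY What] cancels and leaves
   [Idiv What Wstar <= 0]. *)
have := Wsmin _ Whatin; rewrite pyth //; last by split=> //; exists h.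
by rewrite -{2}[Idiv bY What]adde0 leeD2lE // (Idiv_fin (dominated_rescale _ _ _ _)).
Qed.

End Tensors.

Theorem mainTheorem3 (R : realType) (N m : nat) (hm : (1 <= m)%N)
    (Y U : 'M[R]_(N.+1, m)) (hY : nonneg_matrix Y) (hU : nonneg_matrix U) :
  (forall bW Ystar : tensor R N m, H3 bW ->
     is_minimizer (calY Y) (fun bY => Idiv bY bW) Ystar ->
     forall bY : tensor R N m, calY Y bY ->
       Idiv bY bW = (Idiv bY Ystar + Idiv Ystar bW)%E)
  /\
  (forall bY Wstar : tensor R N m, H3 bY ->
     is_minimizer (calW U) (fun bW => Idiv bY bW) Wstar ->
     forall bW : tensor R N m, calW U bW ->
       Idiv bY bW = (Idiv bY Wstar + Idiv Wstar bW)%E).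
Proof.
split=> [bW Ystar W0 Ysmin bY|bY Wstar Y0 Wsmin bW].
  exact: calY_pythagoras.
exact: calW_pythagoras.
Qed.
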